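(* Let $D>0$ be an integer and let $E\subset\mathcal{C}\times\mathcal{C}$ be a $D$-doubling proper Cantor graph, where $\mathcal{C}=\{0,1\}^{\mathbb N}$ is the Cantor set. Then $E$ is almost finite.
   Context: Cantor graphs. A Borel graph on $\mathcal{C}$ is a Borel subset $E\subset \mathcal{C}\times \mathcal{C}$ such that $(x,y)\in E$ implies $(y,x)\in E$, and $(x,x)\in E$ implies $(x,y)\notin E$ for every $y\neq x$ (so there are no loops, only singletons). Bounded degree is assumed: for some integer $d>0$, $|\{y:(x,y)\in E\}|\le d$ for all $x$. A Cantor graph is such a Borel graph $E\subset\mathcal{C}\times\mathcal{C}$ that is a closed subset. $d_E(x,y)$ is the shortest path distance ($\infty$ if $x,y$ are in different components). $(x)_t$ denotes the projection of $x\in\{0,1\}^{\mathbb N}$ to its first $t$ coordinates. $E$ is proper if for any $r>1$ there is $s_r>1$ such that $0<d_E(x,y)\le r$ implies $(x)_{s_r}\neq (y)_{s_r}$. Doubling. A graph $G$ of bounded vertex degrees is $D$-doubling if for any vertex $x$ and any $s\ge1$, $|B_{2s}(G,x)|\le D\,|B_s(G,x)|$, where $B_s(G,x)$ is the ball of radius $s$ around $x$ in $G$; the definition applies to finite, countable and Cantor graphs. Graph of an action. For a continuous action $\alpha:\Gamma\curvearrowright\mathcal{C}$ of a finitely generated group $\Gamma$ with finite symmetric generating set $\Sigma$, the graph $E_\alpha\subset\mathcal{C}\times\mathcal{C}$ consists of the pairs $(x,y)$, $x\ne y$, with $\alpha(\sigma)(x)=y$ for some $\sigma\in\Sigma$,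 together with the pairs $(x,x)$ where $\alpha(\gamma)(x)=x$ for all $\gamma\in\Gamma$. Almost finiteness. For a graph $G$ of bounded vertex degrees and a finite set $H$ of vertices, the isoperimetric constant is $i_G(H)=|\partial(H)|/|H|$, where $\partial(H)$ is the set of $x\in H$ adjacent to some vertex outside $H$. A clopen tower $(S,F)$ of $\alpha$ consists of a clopen set $S\subset\mathcal{C}$ and a finite set $F\subset\Gamma$ such that $\alpha(F)(s)\cap\alpha(F)(t)=\emptyset$ whenever $s\ne t\in S$, where $\alpha(F)(s)=\{\alpha(f)(s): f\in F\}$; the sets $\alpha(F)(s)$, $s\in S$, are the tiles of the tower. Put $i_\alpha((S,F))=\sup_{s\in S} i_{G_s}(\alpha(F)(s))$, where $G_s$ is the component of $s$ in $E_\alpha$. A full clopen $\varepsilon$-castle of $\alpha$ is a finite family of clopen towers $(S_1,F_1),\dots,(S_m,F_m)$ such that all the tiles $\alpha(F_j)(s)$, $1\le j\le m$, $s\in S_j$, form a partition of $\mathcal{C}$, and $i_\alpha((S_j,F_j))\le\varepsilon$ for every $j$. The action $\alpha$ is almost finite if it admits a full clopen $\varepsilon$-castle for every $\varepsilon>0$. A proper Cantor graph $E$ is almost finite if there is an almost finite continuous action $\alpha$ of a finitely generated group (with a finite symmetric generating set) such that $E_\alpha=E$.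
   Formalization: Added: the first projection E→C is an open map, and every point of C lies in some pair of E. Both hold whenever E = E_α; without openness the claim fails (edges 00u–01u and 10u–11u for all u, plus the single edge 000…–100…). *)

(* Defs.v *)
From HB Require Import structures.
From mathcomp Require Import all_boot all_order all_algebra.
From mathcomp Require Import all_classical all_reals all_analysis.
From mathcomp Require Import finmap.

Set Implicit Arguments.
Unset Strict Implicit.
Unset Printing Implicit Defensive.

Import Order.TTheory GRing.Theory Num.Theory.

Local Open Scope classical_set_scope.
Local Open Scope card_scope.

Local Notation C := cantor_space.

Definition prefix_of (t : nat) (x : C) : seq bool := mkseq x t.

(* [fset_set] is only meaningful on finite sets; every set counted below is
   finite because degrees are bounded. *)
Definition ncard (T : choiceType) (A : set T) : nat := (#|` fset_set A |)%fset.

Section Graphs.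

Variable T : choiceType.
Implicit Types (G : set (T * T)) (x y s : T) (H : set T).

Fixpoint walk G (n : nat) x y : Prop :=
  if n is m.+1 then exists z, G (x, z) /\ walk G m z y else x = y.

(* [None] stands for infinite distance. *)
Definition graph_dist G x y : option nat :=
  if pselect (exists n, `[< walk G n x y >]) is left h
  then Some (ex_minn h) else None.

Definition graph_ball G (r : nat) x : set T :=
  [set y | exists2 n, graph_dist G x y = Some n & n <= r].

Definition bounded_degree G : Prop :=
  exists d : nat, 0 < d /\ forall x, [set y | G (x, y)] #<= `I_d.

Definition doubling (D : nat) G : Prop :=
  forall x (s : nat), 1 <= s ->
    ncard (graph_ball G (2 * s) x) <= D * ncard (graph_ball G s x).

Definition component G x : set T := [set y | exists n, walk G n x y].

Definition component_graph G x : set (T * T) :=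
  [set e | [/\ G e, component G x e.1 & component G x e.2]].

Definition vertex_boundary G H : set T :=
  [set x | H x /\ exists y, ~ H y /\ G (x, y)].

Definition isoperimetric (R : realType) G H : R :=
  ((ncard (vertex_boundary G H))%:R / (ncard H)%:R)%R.

End Graphs.

(* The vertex set is the whole Cantor space.  A loop (x, x) is not an edge but
   records that {x} is a component; so, isolated or not, each x occurs in a pair
   of E. *)
Definition borel_graph (E : set (C * C)) : Prop :=
  [/\ <<s [set U : set (C * C) | open U] >> E,
      forall x y, E (x, y) -> E (y, x),
      forall x, E (x, x) -> forall y, y <> x -> ~ E (x, y),
      forall x, exists y, E (x, y) &
      bounded_degree E].

Definition cantor_graph (E : set (C * C)) : Prop :=
  borel_graph E /\ closed E.

Definition proper_graph (E : set (C * C)) : Prop :=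
  forall r : nat, 1 < r -> exists s : nat, 1 < s /\
    forall x y n, graph_dist E x y = Some n -> 0 < n <= r ->
      prefix_of s x <> prefix_of s y.

(* The first projection from E is an open map: a neighbour of x persists, nearby,
   as a neighbour of every point close to x.  The graph of a continuous action
   of a finitely generated group always has this property, so every almost
   finite E has it; but closedness and properness do not imply it.  Join 00u to
   01u and 10u to 11u for every infinite word u, and add one more edge between
   00v and 10v for a single v: this is a 4-doubling proper Cantor graph, and it
   is not the graph of a continuous action. *)
Definition open_projection (E : set (C * C)) : Prop :=
  forall U : set (C * C), open U -> open (fst @` (E `&` U)).

Section Actions.

Variable Gam : groupType.
Implicit Types (Sig F : set Gam) (S : set C).
Implicit Types (alpha : Gam -> C -> C).

Definition continuous_action alpha : Prop :=
  [/\ forall x, alpha 1%g x = x,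
      forall g h x, alpha (g * h)%g x = alpha g (alpha h x) &
      forall g, continuous (alpha g)].

Definition symmetric_set Sig : Prop := forall g, Sig g -> Sig (g^-1)%g.

(* Words in Sig suffice because Sig will be symmetric. *)
Definition generating_set Sig : Prop :=
  forall g, exists w : seq Gam,
    (forall h, h \in w -> Sig h) /\ g = (\big[*%g/1]_(h <- w) h)%g.

Definition action_graph Sig alpha : set (C * C) :=
  [set e | (e.1 <> e.2 /\ exists2 g, Sig g & alpha g e.1 = e.2) \/
           (e.1 = e.2 /\ forall g, alpha g e.1 = e.1)].

Definition tile alpha F (s : C) : set C := [set alpha f s | f in F].

Definition clopen_tower alpha S F : Prop :=
  [/\ clopen S, finite_set F &
      forall s t, S s -> S t -> s <> t ->
        tile alpha F s `&` tile alpha F t = set0].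

Local Open Scope ereal_scope.

Definition tower_isoperimetric (R : realType) Sig alpha S F : \bar R :=
  let E := action_graph Sig alpha in
  ereal_sup [set (isoperimetric R (component_graph E s) (tile alpha F s))%:E
            | s in S].

Definition full_clopen_castle (R : realType) Sig alpha (eps : R)
    (m : nat) (S : 'I_m -> set C) (F : 'I_m -> set Gam) : Prop :=
  [/\ forall j, clopen_tower alpha (S j) (F j),
      partition [set js : 'I_m * C | S js.1 js.2]
                (fun js => tile alpha (F js.1) js.2) [set: C] &
      forall j, tower_isoperimetric R Sig alpha (S j) (F j) <= eps%:E].

Definition almost_finite_action (R : realType) Sig alpha : Prop :=
  forall eps : R, (0 < eps)%R ->
    exists (m : nat) (S : 'I_m -> set C) (F : 'I_m -> set Gam),
      full_clopen_castle Sig alpha eps S F.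

End Actions.

Definition almost_finite (R : realType) (E : set (C * C)) : Prop :=
  exists (Gam : groupType) (Sig : set Gam) (alpha : Gam -> C -> C),
    [/\ finite_set Sig /\ symmetric_set Sig, generating_set Sig,
        continuous_action alpha, action_graph Sig alpha = E &
        almost_finite_action R Sig alpha].

(* Main.v *)
(** A single scale suffices.  Let [X] be a clopen maximal [4q]-separated set.  By
    pigeonhole each [x] in [X] has a radius [r < q] for which the width-two
    annuli at radii [q + r] and [4q + r] contain at most [4 |B_6q(x)| / q]
    points.  Cut the space along these balls: the small ones are disjoint and go
    to their centres, and a remaining point goes to the large ball of least
    colour containing it.  A boundary point of a cell lies in the annuli of some
    nearby centre, so doubling bounds the boundary by [4 D^7 / q] times
    [|B_q(x)|], while the cell contains [B_q(x)].  Every choice depends only on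
    a ball of bounded radius, hence is locally constant because [E] is closed,
    proper and has an open first projection.

    For the group, colour the points so that distinct points at distance at most
    two get distinct colours: the edges with a given pair of colours form a
    partial matching, which defines a continuous involution.  The group generated
    by these involutions has graph [E], and words of length [5q] reach every
    point of a cell from its centre. *)

Require Import Defs.
From HB Require Import structures.
From mathcomp Require Import all_boot all_order all_algebra finmap zify.
From mathcomp Require Import all_classical all_reals all_analysis.

Set Implicit Arguments.
Unset Strict Implicit.
Unset Printing Implicit Defensive.

Import Order.TTheory GRing.Theory Num.Theory.

Local Open Scope classical_set_scope.
Local Open Scope nat_scope.

(** * Cardinality of finite sets *)

Section Ncard.
Variable T : choiceType.
Implicit Types A B : set T.

Lemma ncard_sub A B : finite_set B -> A `<=` B -> ncard A <= ncard B.
Proof.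
move=> finB AB; have finA := sub_finite_set AB finB.
by apply: fsubset_leq_card; rewrite -fset_set_sub.
Qed.

Lemma ncard_gt0 A x : finite_set A -> A x -> 0 < ncard A.
Proof.
move=> finA Ax; rewrite /ncard cardfs_gt0; apply/fset0Pn; exists x.
by rewrite in_fset_set// inE.
Qed.

Lemma ncard_image (U : choiceType) (f : T -> U) A : finite_set A ->
  {in A &, injective f} -> ncard (f @` A) = ncard A.
Proof.
move=> finA injf; rewrite /ncard fset_set_image//; apply: card_in_imfset => //=.
by move=> x y; rewrite /= !in_fset_set//; exact: injf.
Qed.

Lemma ncardDE A B : finite_set A -> B `<=` A ->
  ncard (A `\` B) = ncard A - ncard B.
Proof.
move=> finA BA; have finB := sub_finite_set BA finA.
rewrite /ncard fset_setD// cardfsD; congr (_ - #|` _|).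
by apply/fsetIidPr; rewrite -fset_set_sub.
Qed.

Lemma ncardU_le A B : finite_set A -> finite_set B ->
  ncard (A `|` B) <= ncard A + ncard B.
Proof.
by move=> finA finB; rewrite /ncard fset_setU// cardfsU leq_subr.
Qed.

(** Indicators turn the two bounds that follow into double counts: exchanging sums, each point of
    [A] is counted at most once, respectively at least once. *)
Lemma ncard_sum A B : finite_set A -> B `<=` A ->
  ncard B = \sum_(x <- fset_set A) `[< B x >].
Proof.
move=> finA BA; have finB := sub_finite_set BA finA.
transitivity (\sum_(x <- fset_set A | `[< B x >]) 1).
  rewrite sum1_count -size_filter; apply: perm_size.
  apply: uniq_perm; rewrite ?fset_uniq ?filter_uniq// => x.
  rewrite mem_filter !in_fset_set//; apply/idP/andP.
    by move=> /set_mem Bx; split; [exact/asboolP|exact/mem_set/BA].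
  by move=> [/asboolP Bx _]; exact/mem_set.
by rewrite big_mkcond /=; apply: eq_bigr => x _; case: `[< _ >].
Qed.

Variables (I : eqType) (r : seq I) (F : I -> set T).

Lemma sum_ncard_disjoint A : uniq r -> finite_set A ->
    (forall i, i \in r -> F i `<=` A) ->
    (forall i j x, i \in r -> j \in r -> F i x -> F j x -> i = j) ->
  \sum_(i <- r) ncard (F i) <= ncard A.
Proof.
move=> ur finA FA Fdisj.
rewrite big_seq (eq_bigr (fun i => \sum_(x <- fset_set A) `[< F i x >])); last first.
  by move=> i /FA; exact: ncard_sum.
rewrite -big_seq exchange_big /= /ncard card_fset_sum1; apply: leq_sum => x _.
case: (boolP (has (fun i => `[< F i x >]) r)) => [/hasP[i ir /asboolP Fix]|nF].
  rewrite (bigD1_seq i)//= big_seq_cond big1 ?addn0 ?leq_b1// => j.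
  move=> /andP[jr ji]; case: asboolP => // Fjx.
  by rewrite (Fdisj _ _ _ jr ir Fjx Fix) eqxx in ji.
rewrite big_seq big1// => i ir; case: asboolP => // Fix.
by case/hasP: nF; exists i => //; exact/asboolP.
Qed.

Lemma ncard_cover A : finite_set A -> (forall i, i \in r -> finite_set (F i)) ->
    (forall x, A x -> exists2 i, i \in r & F i x) ->
  ncard A <= \sum_(i <- r) ncard (F i).
Proof.
move=> finA finF AF.
apply: (@leq_trans (\sum_(i <- r) ncard (A `&` F i))); last first.
  rewrite big_seq [leqRHS]big_seq; apply: leq_sum => i ir.
  by apply: ncard_sub; [exact: finF|exact: subIsetr].
under eq_bigr do rewrite (ncard_sum finA (@subIsetl _ _ _)).
rewrite exchange_big /= /ncard card_fset_sum1 big_seq [leqRHS]big_seq.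
apply: leq_sum => x; rewrite in_fset_set// inE => Ax; have [i ir Fix] := AF x Ax.
have r0 : 0 < \sum_(j <- r) `[< (A `&` F j) x >].
  rewrite lt0n sum_nat_seq_neq0; apply/hasP; exists i => //=.
  by rewrite eqb0 negbK; apply/asboolP.
exact: r0.
Qed.

End Ncard.

(** * Balls and locally constant functions *)

Section GraphBalls.
Variables (T : choiceType) (E : set (T * T)).
Hypothesis Esym : forall x y, E (x, y) -> E (y, x).

Lemma graph_ballP r x y :
  graph_ball E r x y <-> exists2 n, n <= r & walk E n x y.
Proof.
rewrite /graph_ball /graph_dist; split=> [[n]|[n nr wn]] /=.
  case: pselect => // h [<-] nr; exists (ex_minn h) => //.
  by case: ex_minnP => k /asboolP.
have h : exists n, `[< walk E n x y >] by exists n; exact/asboolP.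
case: pselect => // h'; exists (ex_minn h') => //.
by case: ex_minnP => k _ /(_ n (asboolT wn)) kn; exact: leq_trans nr.
Qed.

Lemma walk_cat m n x y z : walk E m x y -> walk E n y z -> walk E (m + n) x z.
Proof.
elim: m x => [x ->//|m IHm x [u [xu uy]] yz].
by rewrite addSn /=; exists u; split; last exact: IHm.
Qed.

Lemma walk_sym n x y : walk E n x y -> walk E n y x.
Proof.
elim: n x => [//|n IHn x [u [xu uy]]].
rewrite -addn1; apply: walk_cat (IHn _ uy) _.
by exists x; split=> //; exact: Esym.
Qed.

Lemma graph_ball_sym r x y : graph_ball E r x y -> graph_ball E r y x.
Proof. by move/graph_ballP=> [n nr /walk_sym w]; apply/graph_ballP; exists n. Qed.

Lemma graph_ball_le r s x : r <= s -> graph_ball E r x `<=` graph_ball E s x.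
Proof.
move=> rs y /graph_ballP[n nr w]; apply/graph_ballP; exists n => //.
exact: leq_trans rs.
Qed.

Lemma graph_ball_refl r x : graph_ball E r x x.
Proof. by apply/graph_ballP; exists 0. Qed.

Lemma graph_ball_trans r s x y z :
  graph_ball E r x y -> graph_ball E s y z -> graph_ball E (r + s) x z.
Proof.
move=> /graph_ballP[m mr w] /graph_ballP[n ns w']; apply/graph_ballP.
by exists (m + n); [exact: leq_add|exact: walk_cat w'].
Qed.

Lemma graph_ball0 x y : graph_ball E 0 x y -> x = y.
Proof. by move=> /graph_ballP[[|n]]. Qed.

Lemma graph_ball1 x y : E (x, y) -> graph_ball E 1 x y.
Proof. by move=> xy; apply/graph_ballP; exists 1 => //; exists y. Qed.

Lemma graph_ballS r x y : graph_ball E r.+1 x y <->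
  x = y \/ exists2 z, E (x, z) & graph_ball E r z y.
Proof.
split=> [/graph_ballP[[|n]]|[->|[z xz zy]]].
- by left.
- move=> nr [z [xz zy]]; right; exists z => //.
  by apply/graph_ballP; exists n.
- exact: graph_ball_refl.
- by rewrite -add1n; apply: graph_ball_trans zy; exact: graph_ball1.
Qed.

Lemma finite_graph_ball r x : bounded_degree E -> finite_set (graph_ball E r x).
Proof.
move=> [d [_ Ed]]; elim: r x => [|r IHr] x.
  by apply: (@sub_finite_set _ _ [set x]) => // y /graph_ball0 ->.
apply: (@sub_finite_set _ _ ([set x] `|`
    \bigcup_(z in [set z | E (x, z)]) graph_ball E r z)).
  by move=> y /graph_ballS[->|[z xz zy]]; [left|right; exists z].
rewrite finite_setU; split=> //; apply: bigcup_finite => //.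
by apply/finite_set_leP; exists d.
Qed.

Lemma doubling_exp D k r x : doubling D E -> 0 < r ->
  ncard (graph_ball E (2 ^ k * r) x) <= D ^ k * ncard (graph_ball E r x).
Proof.
move=> dD r0; elim: k => [|k IHk]; first by rewrite !expn0 !mul1n.
rewrite !expnS -!mulnA.
apply: leq_trans (dD _ _ _) _; first by rewrite muln_gt0 expn_gt0.
by rewrite leq_mul2l IHk orbT.
Qed.

End GraphBalls.

Section LocallyConstant.
Variable X : topologicalType.

(** The target carries no topology, so one notion serves numbers, colours and, with values in
    [Prop], sets; composing with any function afterwards preserves it. *)
Definition loc_const (T : Type) (f : X -> T) :=
  forall x, \forall y \near x, f y = f x.

Lemma loc_const_cst (T : Type) (a : T) : loc_const (fun=> a).
Proof. by move=> x; apply: (@filterE _ (nbhs x)). Qed.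

Lemma loc_const_clopen (A : set X) : loc_const A <-> clopen A.
Proof.
split=> [lcA|[oA cA] x].
  suff oA (B : set X) : loc_const B -> open B.
    split; first exact: oA.
    rewrite -openC; apply: oA => x; have := lcA x.
    by apply: filterS => y /= Ayx; rewrite /setC /= Ayx.
  move=> lcB; rewrite openE => x Bx; rewrite /interior; have := lcB x.
  by apply: filterS => y ->.
have [Ax|nAx] := pselect (A x).
  have : nbhs x A by exact: open_nbhs_nbhs.
  by apply: filterS => y Ay; apply/propext; split.
have : nbhs x (~` A) by apply: open_nbhs_nbhs; split => //; rewrite openC.
by apply: filterS => y nAy; apply/propext; split.
Qed.

Lemma loc_const_comp (T U : Type) (f : X -> T) (g : T -> U) :
  loc_const f -> loc_const (g \o f).
Proof. by move=> lf x; have := lf x; apply: filterS => y /= ->. Qed.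

Lemma loc_const_comp2 (T U V : Type) (f : X -> T) (g : X -> U) (h : T -> U -> V) :
  loc_const f -> loc_const g -> loc_const (fun x => h (f x) (g x)).
Proof.
by move=> lf lg x; have := lg x; have := lf x; apply: filterS2 => y -> ->.
Qed.

(** Finitely many neighbourhoods intersect in a neighbourhood. Hence whatever is computed from
    finitely many locally constant data is locally constant. *)
Lemma loc_const_fin (I : finType) (T : Type) (f : I -> X -> T) :
  (forall i, loc_const (f i)) -> loc_const (fun x => f^~ x).
Proof.
move=> lf x; have : \forall y \near x, forall i, f i y = f i x.
  by apply: filter_forall => i; exact: lf.
by apply: filterS => y fyx; apply/funext.
Qed.

Lemma loc_const_exists (I : finType) (A : I -> set X) :
  (forall i, loc_const (A i)) -> loc_const (fun x => exists i, A i x).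
Proof.
move=> lA.
exact: (loc_const_comp (fun B : set I => exists i, B i) (loc_const_fin lA)).
Qed.

End LocallyConstant.

Lemma loc_const_continuous (X Y : topologicalType) (T : Type) (f : X -> T)
  (g : Y -> X) : continuous g -> loc_const f -> loc_const (fun y => f (g y)).
Proof. by move=> cg lf y; exact: (cg y _ (lf (g y))). Qed.

(** * Pigeonhole for annuli *)

Lemma sum_annuli (b : nat -> nat) a q : {homo b : m n / m <= n} ->
  \sum_(r < q) (b (a + r).+2 - b (a + r)) + b a + b a.+1 = b (a + q) + b (a + q).+1.
Proof.
move=> bm; elim: q => [|q IHq]; first by rewrite big_ord0 addn0.
rewrite big_ord_recr /= !addnS.
have := bm (a + q) (a + q).+2 (leq_trans (leqnSn _) (leqnSn _)).
move: IHq; set s := \sum_(i < q) _; lia.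
Qed.

(** If all [q] radii failed, the annuli would sum to more than [4 * b (6 * q)]. Increments of step
    two telescope to two terms at each end, so the sums are at most the values of [b] at [2q],
    [2q + 1], [5q] and [5q + 1], all indices below or equal to [6q]. *)
Lemma small_annuli (b : nat -> nat) q : 0 < q -> {homo b : m n / m <= n} ->
  exists2 r, r < q &
    q * ((b (q + r).+2 - b (q + r)) + (b (4 * q + r).+2 - b (4 * q + r)))
      <= 4 * b (6 * q).
Proof.
move=> q0 bm; apply: contrapT => nex.
have big r : r < q -> 4 * b (6 * q) <
    q * ((b (q + r).+2 - b (q + r)) + (b (4 * q + r).+2 - b (4 * q + r))).
  by move=> rq; rewrite ltnNge; apply/negP => le; apply: nex; exists r.
have : \sum_(r < q) (4 * b (6 * q)).+1 <= \sum_(r < q)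
    q * ((b (q + r).+2 - b (q + r)) + (b (4 * q + r).+2 - b (4 * q + r))).
  by apply: leq_sum => r _; exact: big.
rewrite sum_nat_const card_ord -big_distrr big_split /= leq_pmul2l// => le.
have := sum_annuli q q bm; have := sum_annuli (4 * q) q bm.
have := bm (q + q) (6 * q); have := bm (q + q).+1 (6 * q).
have := bm (4 * q + q) (6 * q); have := bm (4 * q + q).+1 (6 * q).
move: le; set s1 := \sum_(i < q) _; set s2 := \sum_(i < q) _.
lia.
Qed.

(** * The group generated by a family of involutions *)

Section GeneratedGroup.
Variables (I T : Type) (s : I -> T -> T).
Hypothesis sK : forall i, involutive (s i).

Definition word_act (w : seq I) (x : T) : T := foldr s x w.

Lemma word_act_cat w1 w2 : word_act (w1 ++ w2) = word_act w1 \o word_act w2.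
Proof. by apply/funext => x; rewrite /word_act foldr_cat. Qed.

Lemma word_act_revK w : word_act (rev w) \o word_act w = id.
Proof.
elim: w => [//|i w IHw]; rewrite rev_cons -cats1 word_act_cat.
apply/funext => x; rewrite /= sK.
by move/(congr1 (fun f => f x)): IHw.
Qed.

(* The proof [sK] is a parameter of the type because inverses depend on it. *)
Definition gen_group of (forall i, involutive (s i)) : Type :=
  {f : T -> T | exists w, f = word_act w}.

HB.instance Definition _ := gen_eqMixin (gen_group sK).
HB.instance Definition _ := gen_choiceMixin (gen_group sK).

Implicit Types f g h : gen_group sK.

Definition gen_word w : gen_group sK :=
  exist _ (word_act w) (ex_intro _ w erefl).

Lemma sval_gen_word w : sval (gen_word w) = word_act w. Proof. by []. Qed.

Lemma gen_wordP g : exists w, g = gen_word w.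
Proof. by case: g => f [w fw]; exists w; apply: eq_exist. Qed.

Lemma gen_group_inj f g : sval f = sval g -> f = g.
Proof. by case: f g => [f Pf] [g Pg] /= fg; apply: eq_exist. Qed.

(** With a chosen word, products are concatenations and inverses are reversals. The choice is
    immaterial, since by [gen_group_inj] an element is determined by its map. *)
Definition gen_repr g : seq I := sval (cid (gen_wordP g)).

Lemma gen_reprK : cancel gen_repr gen_word.
Proof. by move=> g; rewrite /gen_repr; case: cid. Qed.

Definition gen_mul f g := gen_word (gen_repr f ++ gen_repr g).
Definition gen_one := gen_word [::].
Definition gen_inv g := gen_word (rev (gen_repr g)).

Lemma sval_gen_mul f g : sval (gen_mul f g) = sval f \o sval g.
Proof.
rewrite -[in RHS](gen_reprK f) -[in RHS](gen_reprK g) !sval_gen_word.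
exact: word_act_cat.
Qed.

Fact gen_mulA : associative gen_mul.
Proof. by move=> f g h; apply: gen_group_inj; rewrite !sval_gen_mul. Qed.

Fact gen_mul1 : left_id gen_one gen_mul.
Proof. by move=> f; apply: gen_group_inj; rewrite sval_gen_mul. Qed.

Fact gen_1mul : right_id gen_one gen_mul.
Proof. by move=> f; apply: gen_group_inj; rewrite sval_gen_mul. Qed.

Fact gen_mulV : left_inverse gen_one gen_inv gen_mul.
Proof.
move=> f; apply: gen_group_inj; rewrite sval_gen_mul.
by rewrite -[X in _ \o sval X]gen_reprK !sval_gen_word word_act_revK.
Qed.

Fact gen_Vmul : right_inverse gen_one gen_inv gen_mul.
Proof.
move=> f; apply: gen_group_inj; rewrite sval_gen_mul.
rewrite -[X in sval X \o _]gen_reprK !sval_gen_word.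
by rewrite -[X in word_act X \o _]revK word_act_revK.
Qed.

HB.instance Definition _ :=
  isGroup.Build (gen_group sK) gen_mulA gen_mul1 gen_1mul gen_mulV gen_Vmul.

Lemma sval_mulg f g : sval (f * g)%g = sval f \o sval g.
Proof. exact: sval_gen_mul. Qed.

Lemma prod_gen_word w :
  gen_word w = (\big[*%g/1]_(h <- [seq gen_word [:: i] | i <- w]) h)%g.
Proof.
elim: w => [|i w IHw]; first by rewrite big_nil; apply: gen_group_inj.
rewrite /= big_cons -IHw; apply: gen_group_inj.
by rewrite sval_mulg -cat1s !sval_gen_word word_act_cat.
Qed.

Lemma gen_word1V i : (gen_word [:: i])^-1%g = gen_word [:: i].
Proof.
apply: (mulgI (gen_word [:: i])); rewrite mulgV.
apply: gen_group_inj; rewrite sval_mulg !sval_gen_word.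
by apply/funext => x /=; rewrite sK.
Qed.

End GeneratedGroup.

(** * Locally constant colourings, nets and radii *)

Section CantorGraph.
Local Notation C := cantor_space.
Variable E : set (C * C).
Hypotheses (Ecantor : cantor_graph E) (Eproper : proper_graph E).
Hypothesis Eopen : open_projection E.

Lemma cantor_graph_sym x y : E (x, y) -> E (y, x).
Proof. by case: Ecantor => -[_ + _ _ _] _; exact. Qed.

Lemma cantor_ball_sym r x y : graph_ball E r x y -> graph_ball E r y x.
Proof. exact: graph_ball_sym cantor_graph_sym _ _ _. Qed.

Lemma cantor_graph_finite_ball r x : finite_set (graph_ball E r x).
Proof. by apply: finite_graph_ball; case: Ecantor => -[]. Qed.

Lemma loc_const_coord i : loc_const (fun x : C => x i).
Proof.
move=> x.
exact: (@proj_continuous _ (fun _ => bool) i x _ (discrete_set1 _)).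
Qed.

(** The colour is the prefix whose length properness provides. Colours name the points of a ball in
    a locally constant way, on which the later continuity arguments rest. *)
Lemma exists_coloring r : exists n (c : C -> 'I_n), loc_const c /\
  forall x y, graph_ball E r x y -> c x = c y -> x = y.
Proof.
(* Properness speaks only of radii above one, hence [r.+2]. *)
have [s [_ Es]] := Eproper (isT : 1 < r.+2).
exists _, (fun x => enum_rank [tuple x i | i < s]); split.
  apply: (loc_const_comp (fun h : 'I_s -> bool => enum_rank [tuple h i | i < s])).
  by apply: loc_const_fin => i; exact: loc_const_coord.
move=> x y [n xy nr] /enum_rank_inj cxy; apply: contrapT => xNy.
apply: (Es x y n xy).
  apply/andP; split; last by rewrite (leq_trans nr)// -addn2 leq_addr.
  rewrite lt0n; apply/eqP => n0; apply: xNy.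
  apply: (@graph_ball0 _ E).
  by exists n; rewrite ?n0 // -n0.
apply: (@eq_from_nth _ false); rewrite !size_mkseq// => i i_s.
rewrite !nth_mkseq//.
by have := congr1 (fun t => tnth t (Ordinal i_s)) cxy; rewrite !tnth_mktuple.
Qed.

(** The set is a projection of a piece of [E]: open by [Eopen], and closed because the piece is
    closed in a compact product. *)
Lemma loc_const_nbr (A : set C) :
  loc_const A -> loc_const (fun x => exists2 y, E (x, y) & A y).
Proof.
move=> /loc_const_clopen[oA cA].
have -> : (fun x => exists2 y, E (x, y) & A y) = fst @` (E `&` snd @^-1` A).
  apply/seteqP; split=> [x [y xy Ay]|_ [[x y] [/= xy Ay] <-]]; last by exists y.
  by exists (x, y).
apply/loc_const_clopen; split.
  by apply: Eopen; apply: open_comp => // -[x y] _; exact: cvg_snd.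
apply: compact_closed; first exact: cantor_space_hausdorff.
apply: continuous_compact.
  by apply: continuous_subspaceT => -[x y]; exact: cvg_fst.
apply: (@subclosed_compact _ _ [set: C * C]) => //.
  apply: closedI; first by case: Ecantor.
  by apply: closed_comp => // -[x y] _; exact: cvg_snd.
rewrite -setXTT; apply: compact_setX; exact: cantor_space_compact.
Qed.

Lemma loc_const_ball (A : set C) r :
  loc_const A -> loc_const (fun x => exists2 y, graph_ball E r x y & A y).
Proof.
move=> lA; elim: r => [|r IHr].
  suff -> : (fun x => exists2 y, graph_ball E 0 x y & A y) = A by [].
  apply/seteqP; split=> [x [y /graph_ball0 ->]//|x Ax].
  by exists x => //; exact: graph_ball_refl.
have -> : (fun x => exists2 y, graph_ball E r.+1 x y & A y) =
    (fun x => A x \/ exists2 z, E (x, z) & exists2 y, graph_ball E r z y & A y).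
  apply/seteqP; split=> [x [y /graph_ballS[->|[z xz zy]] Ay]|x [Ax|[z xz [y zy Ay]]]].
  - by left.
  - by right; exists z => //; exists y.
  - by exists x => //; exact: graph_ball_refl.
  - by exists y => //; apply/graph_ballS; right; exists z.
exact: loc_const_comp2 lA (loc_const_nbr IHr).
Qed.

(** Points of one ball are within [r + r], so a colouring at that range is injective on it, and the
    size is the number of colours seen. *)
Lemma loc_const_ncard_ball r : loc_const (fun x => ncard (graph_ball E r x)).
Proof.
have [n [c [lc cinj]]] := exists_coloring (r + r).
have -> : (fun x => ncard (graph_ball E r x)) =
    (fun x => ncard [set i : 'I_n | exists2 y, graph_ball E r x y & c y = i]).
  apply/funext => x; rewrite -(ncard_image (f := c)).
  - by congr ncard; apply/seteqP; split=> i [y xy ci]; exists y.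
  - exact: cantor_graph_finite_ball.
  - move=> y z /set_mem xy /set_mem xz; apply: cinj.
    by apply: graph_ball_trans xz; exact: cantor_ball_sym.
apply: (loc_const_comp (fun B : set 'I_n => ncard B)); apply: loc_const_fin => i.
apply: loc_const_ball.
by apply: (loc_const_comp (fun j => j = i)).
Qed.

(** When [c] separates points within distance [q], points of one colour never conflict, so each
    stage admits all its eligible points at once. *)
Fixpoint greedy_net (n : nat) (c : C -> 'I_n) (q k : nat) : set C :=
  if k is m.+1 then
    [set x | greedy_net c q m x \/ (nat_of_ord (c x) = m /\
       ~ exists2 y, graph_ball E q x y & greedy_net c q m y)]
  else set0.

Lemma exists_net q : exists X : set C, [/\ loc_const X,
  forall x y, X x -> X y -> graph_ball E q x y -> x = y &
  forall x, exists2 y, X y & graph_ball E q y x].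
Proof.
have [n [c [lc cinj]]] := exists_coloring q.
pose net := greedy_net c q.
have net_lt k x : net k x -> c x < k.
  by elim: k => [//|k IHk] /= [/IHk/ltnW//|[<- _]]; exact: ltnSn.
have net_le k l : k <= l -> net k `<=` net l.
  by move=> /subnK <-; elim: (l - k) => [//|m IHm] x /IHm netx; left.
(* A point can enter only at the stage of its own colour. *)
have net_c k x : net k x -> net (c x).+1 x.
  elim: k => [//|k IHk] /= [/IHk//|[<- nx]]; by right.
exists (net n); split.
- suff lnet k : loc_const (net k) by [].
  elim: k => [|m IHm]; first exact: loc_const_cst.
  have lcm : loc_const (fun x => nat_of_ord (c x) = m).
    exact: (loc_const_comp (fun i : 'I_n => nat_of_ord i = m) lc).
  have lN := loc_const_comp not (loc_const_ball q IHm).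
  exact: (loc_const_comp2 or IHm (loc_const_comp2 and lcm lN)).
(* Of two close net points with different colours, the later one would have been refused. *)
- have net_sep x y : net n x -> net n y -> graph_ball E q x y -> ~ (c x < c y).
    move=> nx ny xy cxy; have /= [/net_lt|[_]] := net_c _ _ ny.
      by rewrite ltnn.
    apply; exists x; first exact: (cantor_ball_sym xy).
    exact: net_le cxy _ (net_c _ _ nx).
  move=> x y nx ny xy; apply: cinj (xy) _; apply/val_inj/eqP => /=.
  rewrite eqn_leq; apply/andP; split; rewrite leqNgt; apply/negP.
  exact: net_sep ny nx (cantor_ball_sym xy).
  exact: net_sep nx ny xy.
- move=> x; have [[y xy ny]|nx] :=
    pselect (exists2 y, graph_ball E q x y & net (c x) y).
    exists y; first exact: net_le (ltnW (ltn_ord _)) _ ny.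
    exact: cantor_ball_sym.
  exists x; last exact: graph_ball_refl.
  by apply: (net_le (c x).+1) => //; right.
Qed.

Lemma exists_radius q : 0 < q -> exists rad : C -> nat, loc_const rad /\
  forall x, rad x < q /\ let b r := ncard (graph_ball E r x) in
    q * ((b (q + rad x).+2 - b (q + rad x)) +
         (b (4 * q + rad x).+2 - b (4 * q + rad x))) <= 4 * b (6 * q).
Proof.
move=> q0; pose b x r := ncard (graph_ball E r x).
(* For [r < q] all indices are at most [6 * q], so [inord] is exact. Thus [ok] reads a finite family
   of ball sizes, and the first admissible radius is locally constant. *)
pose ok (u : 'I_(6 * q).+1 -> nat) r := let v i := u (inord i) in
  q * ((v (q + r).+2 - v (q + r)) +
         (v (4 * q + r).+2 - v (4 * q + r))) <= 4 * v (6 * q).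
exists (fun x => find (ok (fun i => b x i)) (iota 0 q)); split.
  apply: (loc_const_comp (fun u => find (ok u) (iota 0 q))).
  by apply: loc_const_fin => i; exact: loc_const_ncard_ball.
move=> x; set r := find _ _.
have bm : {homo b x : m n / m <= n}.
  move=> m n mn; apply: ncard_sub; first exact: cantor_graph_finite_ball.
  exact: graph_ball_le.
have okE k : k < q -> ok (fun i => b x i) k =
    (q * ((b x (q + k).+2 - b x (q + k)) +
         (b x (4 * q + k).+2 - b x (4 * q + k))) <= 4 * b x (6 * q)).
  by move=> kq; rewrite /ok !inordK//; lia.
have rq : has (ok (fun i => b x i)) (iota 0 q).
  have [k kq le] := small_annuli q0 bm; apply/hasP; exists k.
    by rewrite mem_iota.
  by rewrite okE.
have rltq : r < q by rewrite -[leqRHS](size_iota 0) -has_find.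
split=> //=; have := nth_find 0 rq; rewrite nth_iota -/r// add0n.
by rewrite okE.
Qed.

(** * Cells with small boundary *)

Section Tiles.
Variables (q n : nat) (X : set C) (rad : C -> nat) (c : C -> 'I_n).
Hypotheses (q0 : 0 < q) (lX : loc_const X) (lrad : loc_const rad).
Hypothesis lc : loc_const c.
Hypothesis radq : forall x, rad x < q.
Hypothesis radP : forall x, let b r := ncard (graph_ball E r x) in
    q * ((b (q + rad x).+2 - b (q + rad x)) +
         (b (4 * q + rad x).+2 - b (4 * q + rad x))) <= 4 * b (6 * q).
Hypothesis Xsep : forall x y, X x -> X y -> graph_ball E (4 * q) x y -> x = y.
Hypothesis Xmax : forall x, exists2 y, X y & graph_ball E (4 * q) y x.
Hypothesis cinj : forall x y, graph_ball E (10 * q) x y -> c x = c y -> x = y.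

(** The radius is the middle one of its annulus, so that edges crossing the sphere have their ends
    in the annulus. Points outside [X] get the empty set. *)
Definition inner_ball x : set C :=
  [set y | X x /\ graph_ball E (q + rad x).+1 x y].
Definition outer_ball x : set C :=
  [set y | X x /\ graph_ball E (4 * q + rad x).+1 x y].

(* The disjoint inner balls keep the cells large; the rest of the space goes to
   the first outer ball, in the order of the colours, that contains it. *)
Definition cell x : set C := [set y | inner_ball x y \/
  [/\ outer_ball x y, ~ (exists z, inner_ball z y) &
      ~ exists2 z, c z < c x & outer_ball z y]].

Lemma ball_meet r s t x y z : r + s <= t ->
  graph_ball E r x z -> graph_ball E s y z -> graph_ball E t x y.
Proof.
move=> rst xz yz; apply: (graph_ball_le rst).
exact: graph_ball_trans xz (cantor_ball_sym yz).
Qed.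

(** Inner radii are at most [2 * q], so centres of meeting balls are within the separation distance
    [4 * q]. *)
Lemma inner_ball_inj x y z : inner_ball x z -> inner_ball y z -> x = y.
Proof.
move=> [Xx xz] [Xy yz]; apply: Xsep => //; apply: ball_meet xz yz.
by have := radq x; have := radq y; lia.
Qed.

(** Outer radii are at most [5 * q], so centres of meeting outer balls are within [10 * q], where
    [c] tells them apart: the least colour has one owner. *)
Lemma cell_inj x y z : cell x z -> cell y z -> x = y.
Proof.
move=> [xz|[xz nz xlt]] [yz|[yz nz' ylt]].
- exact: inner_ball_inj xz yz.
- by case: nz'; exists x.
- by case: nz; exists y.
- have cxy : c x = c y.
    apply/val_inj/eqP; rewrite /= eqn_leq; apply/andP.
    by split; rewrite leqNgt; apply/negP => lt;
      [apply: xlt; exists y|apply: ylt; exists x].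
  apply: cinj cxy; apply: ball_meet xz.2 yz.2.
  by have := radq x; have := radq y; lia.
Qed.

Lemma cell_cover y : exists2 x, X x & cell x y.
Proof.
have [[x xy]|nin] := pselect (exists x, inner_ball x y).
  by exists x; [case: xy|left].
pose P k := `[< exists2 z, nat_of_ord (c z) = k & outer_ball z y >].
have exP : exists k, P k.
  have [z Xz zy] := Xmax y; exists (c z); apply/asboolP; exists z => //.
  by split=> //; apply: graph_ball_le zy; lia.
case: (ex_minnP exP) => k /asboolP[x cx xy] kmin; exists x; first by case: xy.
right; split=> // -[z czx zy]; move: czx; rewrite cx ltnNge => /negP; apply.
by apply: kmin; apply/asboolP; exists z.
Qed.

Lemma cell_sub x : cell x `<=` graph_ball E (5 * q) x.
Proof.
by move=> y [[_]|[[_ + _ _]]]; apply: graph_ball_le; have := radq x; lia.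
Qed.

Lemma sub_cell x : X x -> graph_ball E q x `<=` cell x.
Proof.
by move=> Xx y xy; left; split=> //; apply: graph_ball_le xy; lia.
Qed.

Definition annuli x : set C :=
  (graph_ball E (q + rad x).+2 x `\` graph_ball E (q + rad x) x) `|`
  (graph_ball E (4 * q + rad x).+2 x `\` graph_ball E (4 * q + rad x) x).

(** An edge changes the distance to [x] by at most one. *)
Lemma cross_annulus r x y y' : E (y, y') ->
  ~ (graph_ball E r.+1 x y <-> graph_ball E r.+1 x y') ->
  (graph_ball E r.+2 x `\` graph_ball E r x) y.
Proof.
move=> yy' nxy; have y'y := cantor_graph_sym yy'.
have step z w s : E (z, w) -> graph_ball E s x z -> graph_ball E s.+1 x w.
  by move=> zw xz; rewrite -addn1; apply: graph_ball_trans xz (graph_ball1 zw).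
split=> [|xy].
  apply: contrapT => xNy; apply: nxy; split=> [xy|xy'].
    by case: xNy; apply: graph_ball_le xy.
  by case: xNy; exact: step y'y xy'.
apply: nxy; split=> _; first exact: step yy' xy.
by apply: graph_ball_le xy.
Qed.

(** Membership in a cell depends only on which inner and outer balls contain the point, so an edge
    leaving the cell crosses the ball of some centre [z]. Then [y] is within [6 * q] of [z] and
    [5 * q] of [x]. *)
Lemma cell_boundary x y : vertex_boundary E (cell x) y ->
  exists2 z, X z /\ graph_ball E (11 * q) x z & annuli z y.
Proof.
move=> [xy [y' [xNy' yy']]].
suff [z Xz zy] : exists2 z, X z & annuli z y.
  exists z => //; split=> //.
  suff zy6 : graph_ball E (6 * q) z y by apply: ball_meet (cell_sub xy) zy6; lia.
  by case: zy => -[+ _]; apply: graph_ball_le; have := radq z; lia.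
apply: contrapT => nex.
have same z : (inner_ball z y <-> inner_ball z y') /\
    (outer_ball z y <-> outer_ball z y').
  have [Xz|nXz] := pselect (X z); last by split; split=> -[].
  split; apply: contrapT => nzy; apply: nex; exists z => //; [left|right];
    apply: (cross_annulus yy') => zyy'; apply: nzy; rewrite /inner_ball /outer_ball /=;
    by split=> -[_ /zyy'].
apply: xNy'; case: xy => [xy|[xy nin nlt]]; first by left; apply/(same x).1.
right; split; first exact/(same x).2.
  by move=> [z /(same z).1 zy]; apply: nin; exists z.
by move=> [z czx /(same z).2 zy]; apply: nlt; exists z.
Qed.

Lemma ncard_annuli x : q * ncard (annuli x) <= 4 * ncard (graph_ball E (6 * q) x).
Proof.
apply: leq_trans (radP x) => /=; rewrite leq_mul2l; apply/orP; right.
have fin r := cantor_graph_finite_ball r x.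
apply: leq_trans (ncardU_le _ _) _; try exact: finite_setD.
by rewrite !ncardDE//; apply: graph_ball_le; lia.
Qed.

(** Since [6 <= 2 ^ 3], the annuli of each nearby centre [z] cost at most [4 * D ^ 3 / q] times the
    [q]-ball of [z]. These [q]-balls are disjoint inside the [12q]-ball of [x], which, since
    [12 <= 2 ^ 4], is at most [D ^ 4] times the [q]-ball of [x], a part of the cell. *)
Lemma cell_isoperimetric D x : doubling D E -> X x ->
  q * ncard (vertex_boundary E (cell x)) <= 4 * D ^ 7 * ncard (cell x).
Proof.
move=> Edbl Xx; pose Z := fset_set (X `&` graph_ball E (11 * q) x).
have fin r y := cantor_graph_finite_ball r y.
have finZ : finite_set (X `&` graph_ball E (11 * q) x).
  exact: sub_finite_set (@subIsetr _ _ _) (fin _ _).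
have finc : finite_set (cell x) by exact: sub_finite_set (@cell_sub x) (fin _ _).
have ZP z : z \in Z -> X z /\ graph_ball E (11 * q) x z.
  by rewrite in_fset_set// => /set_mem.
have ball_double k r y : r <= 2 ^ k * q ->
    ncard (graph_ball E r y) <= D ^ k * ncard (graph_ball E q y).
  move=> rk; apply: leq_trans (doubling_exp _ _ Edbl q0).
  by apply: ncard_sub => //; exact: graph_ball_le.
have le1 : ncard (vertex_boundary E (cell x)) <= \sum_(z <- Z) ncard (annuli z).
  apply: ncard_cover.
  - by apply: sub_finite_set finc => y [].
  - by move=> z _; rewrite finite_setU; split; exact: finite_setD.
  - move=> y /cell_boundary[z zP zy]; exists z => //.
    by rewrite in_fset_set//; apply: mem_set.
have le2 : \sum_(z <- Z) ncard (graph_ball E q z) <= ncard (graph_ball E (12 * q) x).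
  apply: sum_ncard_disjoint => //.
  - move=> z /ZP[_ xz] y zy; have := graph_ball_trans xz zy.
    by apply: graph_ball_le; lia.
  - move=> z w y /ZP[Xz _] /ZP[Xw _] zy wy; apply: Xsep => //.
    by apply: ball_meet zy wy; lia.
apply: (@leq_trans (\sum_(z <- Z) 4 * (D ^ 3 * ncard (graph_ball E q z)))).
  apply: (@leq_trans (q * \sum_(z <- Z) ncard (annuli z))).
    by rewrite leq_mul2l le1 orbT.
  rewrite big_distrr /=; apply: leq_sum => z _.
  apply: leq_trans (ncard_annuli z) _; rewrite leq_mul2l /=; apply: ball_double.
  by lia.
rewrite -!big_distrr /= -mulnA leq_mul2l /=.
have -> : D ^ 7 = D ^ 3 * D ^ 4 by rewrite -expnD.
rewrite -mulnA leq_mul2l; apply/orP; right; apply: leq_trans le2 _.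
apply: leq_trans (ball_double 4 _ x _) _; first by lia.
by rewrite leq_mul2l ncard_sub ?orbT//; exact: sub_cell.
Qed.

(** The bound on [k] splits the condition into finitely many with a fixed radius. *)
Lemma loc_const_ball_radius (A : set C) (k : C -> nat) m :
  loc_const A -> loc_const k -> (forall z, k z <= m) ->
  loc_const (fun y => exists2 z, A z & graph_ball E (k z) z y).
Proof.
move=> lA lk km.
have -> : (fun y => exists2 z, A z & graph_ball E (k z) z y) =
    (fun y => exists i : 'I_m.+1, exists2 z, graph_ball E i y z & A z /\ k z = i).
  apply/seteqP; split=> [y [z Az zy]|y [i [z yz [Az kz]]]].
    by exists (@Ordinal m.+1 _ (km z)), z => //; exact: cantor_ball_sym.
  by exists z => //; rewrite kz; exact: cantor_ball_sym.
apply: loc_const_exists => i; apply: loc_const_ball.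
exact: (loc_const_comp2 and lA (loc_const_comp (fun j : nat => j = i) lk)).
Qed.

(** * Local constancy of the cells *)

Section CellContinuity.
Variable g : C -> C.
Hypotheses (cg : continuous g) (gball : forall x, graph_ball E (5 * q) x (g x)).

(** As [g x] is within [5 * q] of [x], it lies in the smaller ball exactly when that ball contains a
    point of its colour. *)
Lemma loc_const_ball_graph (k : C -> nat) :
  loc_const k -> (forall z, k z <= 5 * q) ->
  loc_const (fun x => graph_ball E (k x) x (g x)).
Proof.
move=> lk km.
have -> : (fun x => graph_ball E (k x) x (g x)) = (fun x =>
    exists ij : 'I_(5 * q).+1 * 'I_n, (k x = ij.1 /\ c (g x) = ij.2) /\
      exists2 y, graph_ball E ij.1 x y & c y = ij.2).
  apply/seteqP; split=> [x xgx|x [[i j] /= [[kx cgx] [y xy cy]]]].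
    by exists (@Ordinal (5 * q).+1 _ (km x), c (g x)) => /=; split=> //; exists (g x).
  suff <- : y = g x by rewrite kx.
  apply: cinj; last by rewrite cy.
  apply: ball_meet (cantor_ball_sym xy) (cantor_ball_sym (gball x)).
  by have := ltn_ord i; lia.
apply: loc_const_exists => -[i j] /=.
have lcj := loc_const_comp (fun l => l = j) lc.
apply: (loc_const_comp2 and (loc_const_comp2 and _ _)).
- exact: (loc_const_comp (fun l : nat => l = i) lk).
- exact: loc_const_continuous cg lcj.
- exact: loc_const_ball lcj.
Qed.

Lemma loc_const_cell : loc_const (fun x => X x /\ cell x (g x)).
Proof.
have lrad' a : loc_const (fun x => (a + rad x).+1).
  exact: (loc_const_comp (fun r => (a + r).+1) lrad).
have le_outer z : (4 * q + rad z).+1 <= 5 * q by have := radq z; lia.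
have le_inner z : (q + rad z).+1 <= 5 * q by have := radq z; lia.
have lin := loc_const_comp2 and lX (loc_const_ball_graph (lrad' q) le_inner).
have lout := loc_const_comp2 and lX (loc_const_ball_graph (lrad' (4 * q)) le_outer).
have lexin : loc_const (fun x => exists z, inner_ball z (g x)).
  have := loc_const_continuous cg (loc_const_ball_radius lX (lrad' q) le_inner).
  congr loc_const; apply/funext => x; apply/propext.
  by split=> [[z Xz zx]|[z [Xz zx]]]; exists z.
have lexout : loc_const (fun x => exists2 z, c z < c x & outer_ball z (g x)).
  (* The comparison of [c z] with [c x] involves both points; fixing the value [i] of [c x]
     separates them. *)
  have lclt (i : 'I_n) := loc_const_comp2 and lX
    (loc_const_comp (fun j : 'I_n => j < i : Prop) lc).
  have lout' i := loc_const_continuous cg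
    (loc_const_ball_radius (lclt i) (lrad' (4 * q)) le_outer).
  have := loc_const_exists (fun i =>
    loc_const_comp2 and (loc_const_comp (fun j => j = i) lc) (lout' i)).
  congr loc_const; apply/funext => x; apply/propext; split.
    by move=> [i [/= <- [z [Xz cz] zx]]]; exists z.
  by move=> [z cz [Xz zx]]; exists (c x); split=> //; exists z.
apply: (loc_const_comp2 and lX _); apply: (loc_const_comp2 or lin _).
have lN := loc_const_comp2 and lout
  (loc_const_comp2 and (loc_const_comp not lexin) (loc_const_comp not lexout)).
move: lN; congr loc_const; apply/funext => x; apply/propext.
by split=> [[? []]|[]].
Qed.

End CellContinuity.
End Tiles.

(** The last clause is meant for words in the flips: the words that lead from a centre into its cell
    are locally constant in the centre. *)
Lemma exists_cells D q : 0 < q -> doubling D E ->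
  exists (X : set C) (H : C -> set C),
  [/\ forall x, X x -> H x x,
      forall x y z, H x z -> H y z -> x = y,
      forall y, exists2 x, X x & H x y,
      forall x, H x `<=` graph_ball E (5 * q) x &
      (forall x, X x -> q * ncard (vertex_boundary E (H x)) <=
                       4 * D ^ 7 * ncard (H x)) /\
      forall g : C -> C, continuous g ->
        (forall x, graph_ball E (5 * q) x (g x)) ->
        loc_const (fun x => X x /\ H x (g x))].
Proof.
move=> q0 Edbl; have [rad [lrad radP]] := exists_radius q0.
have [X [lX Xsep Xmax]] := exists_net (4 * q).
have [n [c [lc cinj]]] := exists_coloring (10 * q).
have radq x := (radP x).1; have {}radP x := (radP x).2.
exists X, (cell q X rad c); split.
- by move=> x Xx; apply: sub_cell => //; exact: graph_ball_refl.
- exact: cell_inj.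
- exact: cell_cover.
- exact: cell_sub.
- by split=> [x Xx|g cg gb]; [exact: cell_isoperimetric|exact: loc_const_cell].
Qed.

(** * The action by coloured matchings *)

Section Flips.
Variables (n : nat) (c : C -> 'I_n).
Hypothesis lc : loc_const c.
Hypothesis cinj : forall x y, graph_ball E 2 x y -> c x = c y -> x = y.

Definition edge_colored (ij : 'I_n * 'I_n) (x y : C) : Prop :=
  E (x, y) /\ (c x = ij.1 /\ c y = ij.2 \/ c x = ij.2 /\ c y = ij.1).

(* [None] acts trivially, so that words can be padded to a given length. *)
Definition flip (o : option ('I_n * 'I_n)) (x : C) : C :=
  if o is Some ij then xget x [set y | edge_colored ij x y] else x.

Lemma edge_colored_sym ij x y : edge_colored ij x y -> edge_colored ij y x.
Proof. by move=> [/cantor_graph_sym yx [[]|[]]]; split=> //; [right|left]. Qed.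

(** Two neighbours of [x] are within distance two, and here they have the same colour. *)
Lemma edge_colored_inj ij x y z : edge_colored ij x y -> edge_colored ij x z -> y = z.
Proof.
move=> [xy cxy] [xz cxz]; apply: cinj.
  apply: (graph_ball_trans (r := 1) (s := 1) (y := x)); last exact: graph_ball1.
  by apply: graph_ball1; exact: cantor_graph_sym.
by case: cxy cxz => -[cx cy] [] [cx' cz]; rewrite cy cz -?cx -?cx'.
Qed.

Lemma flipE ij x y : edge_colored ij x y -> flip (Some ij) x = y.
Proof.
by move=> xy; apply: xget_unique => // z xz; exact: edge_colored_inj xz xy.
Qed.

Lemma flip_id ij x : ~ (exists y, edge_colored ij x y) -> flip (Some ij) x = x.
Proof. by move=> nx; apply: xgetPN => y xy; apply: nx; exists y. Qed.

Lemma flipK o : involutive (flip o).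
Proof.
move=> x; case: o => [ij|//].
have [[y xy]|nx] := pselect (exists y, edge_colored ij x y).
  by rewrite (flipE xy) (flipE (edge_colored_sym xy)).
by rewrite !(flip_id nx).
Qed.

Lemma flip_edge o x : flip o x <> x -> E (x, flip o x).
Proof.
case: o => [ij|//]; have [[y xy]|nx] := pselect (exists y, edge_colored ij x y).
  by rewrite (flipE xy); case: xy.
by rewrite (flip_id nx).
Qed.

Lemma edge_flip x y : E (x, y) -> exists o, flip o x = y.
Proof. by move=> xy; exists (Some (c x, c y)); apply: flipE; split=> //; left. Qed.

(** The preimage of [A] consists of the points matched into [A], an open set by [Eopen], and the
    unmatched points of [A], open because being matched is a clopen condition. *)
Lemma continuous_flip o : continuous (flip o).
Proof.
case: o => [ij|]; last by move=> x; exact: cvg_id.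
apply/continuousP => A oA; set B := _ @^-1` A.
pose N (A' : set C) := [set x | exists2 y, A' y & edge_colored ij x y].
have NE A' : N A' = (([set x | c x = ij.1] `&`
     fst @` (E `&` (snd @^-1` (A' `&` [set y | c y = ij.2])))) `|`
    ([set x | c x = ij.2] `&`
     fst @` (E `&` (snd @^-1` (A' `&` [set y | c y = ij.1]))))).
  apply/seteqP; split=> [x [y A'y [xy [[cx cy]|[cx cy]]]]|x].
  - by left; split=> //; exists (x, y).
  - by right; split=> //; exists (x, y).
  - by move=> [[cx [[u y] [/= xy [A'y cy] ux]]]|[cx [[u y] [/= xy [A'y cy] ux]]]];
      rewrite ux in xy; exists y => //; split=> //; [left|right].
have oc i : clopen [set x | c x = i].
  by apply/loc_const_clopen; exact: (loc_const_comp (fun j => j = i) lc).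
have oN A' : open A' -> open (N A').
  move=> oA'; rewrite NE; apply: openU; apply: openI; try exact: (oc _).1;
  by apply: Eopen; apply: open_comp => [z _|];
    [exact: cvg_snd|apply: openI; try exact: (oc _).1].
have lc' i := loc_const_comp (fun j => j = i) lc.
have ldom : loc_const [set x | exists y, edge_colored ij x y].
  have := loc_const_comp2 or
    (loc_const_comp2 and (lc' ij.1) (loc_const_nbr (lc' ij.2)))
    (loc_const_comp2 and (lc' ij.2) (loc_const_nbr (lc' ij.1))).
  congr loc_const; apply/seteqP; split=> x.
    by move=> [[cx [y xy cy]]|[cx [y xy cy]]]; exists y; split=> //; [left|right].
  by move=> [y [xy [[cx cy]|[cx cy]]]]; [left|right]; split=> //; exists y.
have BE x : B x = A (flip (Some ij) x) by [].
have -> : B = N A `|` (A `&` ~` [set x | exists y, edge_colored ij x y]).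
  apply/seteqP; split=> x; rewrite BE.
    have [[y xy]|nx] := pselect (exists y, edge_colored ij x y).
      by rewrite (flipE xy) => Ay; left; exists y.
    by rewrite (flip_id nx) => Ax; right.
  by move=> [[y Ay xy]|[Ax nx]]; rewrite ?(flipE xy) ?(flip_id nx).
apply: openU; first exact: oN.
by apply: openI => //; rewrite openC; case/loc_const_clopen: ldom.
Qed.

Lemma continuous_word_flip w : continuous (word_act flip w).
Proof.
elim: w => [|o w IHw] x; first exact: cvg_id.
exact: (continuous_comp (IHw x) (@continuous_flip o _)).
Qed.

Lemma word_flip_ball w x : graph_ball E (size w) x (word_act flip w x).
Proof.
elim: w x => [|o w IHw] x; first exact: graph_ball_refl.
rewrite /= -addn1; apply: graph_ball_trans (IHw x) _.
have [->|ne] := pselect (flip o (word_act flip w x) = word_act flip w x).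
  exact: graph_ball_refl.
by apply: graph_ball1; exact: flip_edge.
Qed.

Lemma ball_word_flip r x y : graph_ball E r x y ->
  exists w : r.-tuple (option ('I_n * 'I_n)), word_act flip w x = y.
Proof.
elim: r x => [|r IHr] x; first by move/graph_ball0 => <-; exists [tuple].
move/graph_ballS => [->|[z xz /IHr[w wzy]]].
  by exists [tuple of nseq r.+1 None]; rewrite /=; elim: (r).
(* The last letter acts first, so the first edge of the path is appended at the end. *)
have [i ixz] := edge_flip xz; exists [tuple of rcons w i].
by rewrite /= -cats1 word_act_cat /= ixz.
Qed.

End Flips.

(** * The flip group and its castles *)

Section FlipAction.
Variables (n : nat) (c : C -> 'I_n).
Hypothesis lc : loc_const c.
Hypothesis cinj : forall x y, graph_ball E 2 x y -> c x = c y -> x = y.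

Let letter : finType := option ('I_n * 'I_n).
Let flipI : forall i : letter, involutive (flip c i) := flipK cinj.

Definition flip_group := gen_group flipI.
Definition flip_gens : set flip_group :=
  [set gen_word flipI [:: i] | i in [set: letter]].
Definition flip_action (g : flip_group) : C -> C := sval g.

Lemma symmetric_flip_gens : symmetric_set flip_gens.
Proof. by move=> _ [i _ <-]; exists i => //; rewrite gen_word1V. Qed.

Lemma generating_flip_gens : generating_set flip_gens.
Proof.
move=> g; have [w ->] := gen_wordP g.
exists [seq gen_word flipI [:: i] | i <- w]; split; last exact: prod_gen_word.
by move=> h /mapP[i _ ->]; exists i.
Qed.

Lemma continuous_flip_action : continuous_action flip_action.
Proof.
split=> [//|g h x|g]; first by rewrite /flip_action sval_mulg.
by have [w ->] := gen_wordP g; exact: continuous_word_flip.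
Qed.

(** A global fixed point has some neighbour, which a flip reaches, so the neighbour is the point
    itself. Conversely, a point with a loop has no other neighbour, so every flip fixes it. *)
Lemma flip_action_graph : action_graph flip_gens flip_action = E.
Proof.
apply/seteqP; split=> -[x y] /=.
  case=> /= [[xy [_ [i _ <-] ixy]]|[<- fix_x]].
    by rewrite -ixy; apply: (flip_edge cinj) => ix; apply: xy; rewrite -ixy /= ix.
  have [z xz] : exists z, E (x, z) by case: Ecantor => -[_ _ _ + _] _; exact.
  have [i ixz] := edge_flip cinj xz.
  have zx : z = x by rewrite -ixz; exact: (fix_x (gen_word flipI [:: i])).
  by rewrite zx in xz.
move=> xy; have [xy'|ne] := pselect (x = y); last first.
  left; split=> //; have [i ixy] := edge_flip cinj xy.
  by exists (gen_word flipI [:: i]) => //; exists i.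
right; split=> // g; have [w ->] := gen_wordP g; rewrite -xy' in xy.
rewrite /flip_action /=; elim: w => [//|i w /= ->].
apply: contrapT => ne; have := flip_edge cinj ne.
by case: Ecantor => -[_ _ + _ _] _; apply.
Qed.

Lemma almost_finite_flip_action (R : realType) D : doubling D E ->
  almost_finite_action R flip_gens flip_action.
Proof.
move=> Edbl eps eps0.
(* This makes the isoperimetric bound [4 * D ^ 7 / q] at most [eps]. *)
pose q := (Num.truncn ((4 * D ^ 7)%:R / eps)%R).+1.
have qeps : ((4 * D ^ 7)%:R <= eps * q%:R :> R)%R.
  rewrite mulrC -ler_pdivrMr// ltW//.
  exact: truncnS_gt.
have [X [H [HX Hinj Hcov Hsub [Hiso lH]]]] := exists_cells (ltn0Sn _ : 0 < q) Edbl.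
pose W : finType := (5 * q).-tuple letter.
(* Centres are grouped by the exact set [A] of words leading into their own cell. There are finitely
   many such sets, and on each group the same group elements sweep out the cell. *)
pose S (A : {set W}) : set C :=
  [set x | X x /\ forall w : W, w \in A <-> X x /\ H x (word_act (flip c) w x)].
pose F (A : {set W}) : set flip_group :=
  [set gen_word flipI w | w in [set w : W | w \in A]].
have wball (w : W) x : graph_ball E (5 * q) x (word_act (flip c) w x).
  by have := word_flip_ball cinj w x; rewrite size_tuple.
have tileE A x : S A x -> tile flip_action (F A) x = H x.
  move=> [Xx SA]; apply/seteqP; split=> [_ [_ [w /= /SA[_ Hw] <-] <-]//|y Hy].
  have [w wy] := ball_word_flip cinj (Hsub _ _ Hy).
  exists (gen_word flipI w) => //; exists w => //=; apply/SA.
  by rewrite wy.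
(* The case of the identity map, since a centre lies in its own cell. *)
have lX : loc_const X.
  have := lH id (fun x => @cvg_id _ (nbhs x)) (graph_ball_refl E _).
  by congr loc_const; apply/seteqP; split=> x => [[]|Xx] //; split=> //; exact: HX.
have finH x : finite_set (H x).
  exact: sub_finite_set (@Hsub x) (cantor_graph_finite_ball _ _).
have clS A : clopen (S A).
  apply/loc_const_clopen; apply: (loc_const_comp2 and lX _).
  apply: (loc_const_comp (fun h : W -> Prop => forall w : W, w \in A <-> h w)).
  apply: loc_const_fin => w; apply: lH => // x.
  exact: continuous_word_flip.
exists #|{set W}|, (fun j => S (enum_val j)), (fun j => F (enum_val j)); split.
- move=> j; split=> //.
    by apply: finite_image; exact: finite_finset.
  move=> s t Ss St st; rewrite !tileE//; apply/seteqP; split=> // z [Hs Ht].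
  by apply: st; exact: Hinj Hs Ht.
- split.
  + apply/seteqP; split=> // y _; have [x Xx Hxy] := Hcov y.
    pose A : {set W} := [set w : W | `[< X x /\ H x (word_act (flip c) w x) >]]%SET.
    have SA : S A x.
      by split=> // w; rewrite finset.inE; split=> /asboolP.
    exists (enum_rank A, x); first by rewrite /= enum_rankK.
    by rewrite /= enum_rankK tileE.
  + move=> [j s] [k t] /= Ss St [y [/= ]]; rewrite !tileE// => Hs Ht.
    (* Meeting tiles share their centre, and the centre determines its set of words. *)
    have st := Hinj _ _ _ Hs Ht; rewrite -st in St *; congr (_, _).
    apply: enum_val_inj; apply/setP => w.
    by apply/idP/idP => [/Ss.2/St.2|/St.2/Ss.2].
  + by move=> [j s] /= Ss; rewrite tileE//; exists s; apply: HX; case: Ss.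
- move=> j; apply: ub_ereal_sup => _ [s Ss <-]; rewrite tileE// lee_fin.
  have Xs := Ss.1; rewrite flip_action_graph /isoperimetric.
  have H0 : 0 < ncard (H s) by apply: ncard_gt0 (HX _ Xs).
  rewrite ler_pdivrMr ?ltr0n//.
  have q0 : (0 < q%:R :> R)%R by rewrite ltr0n.
  rewrite -(ler_pM2l q0).
  apply: (@le_trans _ _ (4 * D ^ 7 * ncard (H s))%:R%R).
    rewrite -natrM ler_nat; apply: leq_trans (Hiso _ Xs); rewrite leq_mul2l.
    (* The boundary taken in the component of [s] is contained in the boundary taken in [E]. *)
    apply/orP; right; apply: ncard_sub; first by apply: sub_finite_set (finH s) => y [].
    by move=> y [Hy [z [nz [ez _ _]]]]; split=> //; exists z.
  by rewrite natrM mulrA ler_wpM2r// mulrC.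
Qed.

End FlipAction.

Lemma doubling_almost_finite (R : realType) D : doubling D E -> almost_finite R E.
Proof.
move=> Edbl; have [n [c [lc cinj]]] := exists_coloring 2.
exists (flip_group cinj), (@flip_gens _ _ cinj), (@flip_action _ _ cinj); split.
- split; first by apply: finite_image; exact: finite_finset.
  exact: symmetric_flip_gens.
- exact: generating_flip_gens.
- exact: continuous_flip_action.
- exact: flip_action_graph.
- exact: almost_finite_flip_action Edbl.
Qed.

End CantorGraph.

Theorem theorem1 (R : realType) (D : nat) (hD : 0 < D)
    (E : set (cantor_space * cantor_space)) (hE : cantor_graph E) (hproper : proper_graph E)
    (hopen : open_projection E) (hdoubling : doubling D E) :
  almost_finite R E.
Proof. exact: doubling_almost_finite hdoubling. Qed.
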